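(* For any constant $\varepsilon<1/4$, the following holds for all integers $k\ge3$ and all $n$: there is a family of directed graphs with no more than $n$ vertices and edges such that any random order streaming algorithm that $\varepsilon$-approximates the distribution of length-$k$ random walks on graphs drawn from the family uses $\Omega(n)$ bits of space, with the constant factor depending only on $\varepsilon$.
   Context: A random order streaming algorithm receives the edges of the input graph in a uniformly random order. In a directed graph a random walk step moves along a uniformly random out-edge of the current vertex. An algorithm $\varepsilon$-approximates the distribution of length-$k$ random walks if its output is $\varepsilon$-close in total variation distance to the distribution of a $k$-step random walk started at a uniformly random vertex of the graph. *)

(* Defs.v *)
From mathcomp Require Import all_boot all_order all_algebra.
From mathcomp Require Import reals.

Set Implicit Arguments.
Unset Strict Implicit.
Unset Printing Implicit Defensive.

Import Order.TTheory GRing.Theory Num.Theory.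

Local Open Scope ring_scope.

(* A directed graph on the vertex set V is given by its set of arcs
   E : {set V * V}, the arc (u, v) going from u to v. *)

Definition outdeg (V : finType) (E : {set V * V}) (u : V) : nat :=
  #|[set v | (u, v) \in E]|.

Definition loopless (V : finType) (E : {set V * V}) : Prop :=
  forall u : V, (u, u) \notin E.

(* Every vertex has an out-arc, so that random walks never get stuck. *)
Definition sinkless (V : finType) (E : {set V * V}) : Prop :=
  forall u : V, (0 < outdeg E u)%N.

Definition step_prob (R : realType) (V : finType) (E : {set V * V})
    (u v : V) : R :=
  ((u, v) \in E)%:R / (outdeg E u)%:R.

(* A walk with k steps is recorded as the tuple of its k + 1 vertices. *)
Definition walk_prob (R : realType) (V : finType) (k : nat)
    (E : {set V * V}) (w : k.+1.-tuple V) : R :=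
  #|V|%:R^-1 *
  \prod_(i < k) step_prob R E (tnth w (widen_ord (leqnSn k) i))
                              (tnth w (lift ord0 i)).

Definition total_variation (R : realType) (T : finType) (p q : T -> R) : R :=
  2^-1 * \sum_(x : T) `|p x - q x|.

(* A randomized algorithm that reads a stream of arcs on V and outputs a
   (k + 1)-tuple of vertices, with S bits of memory.  Only the memory carried
   from one arc to the next is charged: the algorithm is non-uniform (it may
   depend on V, k and S), and its random seed, of arbitrary finite
   distribution, can be read for free at any time.  Fresh coins at each update
   are the special case of a seed made of independent parts, one for each
   memory state and arc, since no arc occurs twice in a stream. *)
Record stream_alg (R : realType) (V : finType) (k S : nat) := StreamAlg {
  seed : finType;
  seed_prob : seed -> R;
  seed_prob_ge0 : forall r, 0 <= seed_prob r;
  seed_prob_sum1 : \sum_(r : seed) seed_prob r = 1;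
  init : seed -> S.-tuple bool;
  update : seed -> S.-tuple bool -> V * V -> S.-tuple bool;
  output : seed -> S.-tuple bool -> k.+1.-tuple V
}.

Definition run (R : realType) (V : finType) (k S : nat)
    (A : stream_alg R V k S) (r : seed A) (s : seq (V * V)) : k.+1.-tuple V :=
  output r (foldl (update r) (init r) s).

(* The probability that A outputs w, over its seed and a uniformly random
   order of the arcs of E. *)
Definition output_prob (R : realType) (V : finType) (k S : nat)
    (A : stream_alg R V k S) (E : {set V * V}) (w : k.+1.-tuple V) : R :=
  (#|E|`!)%:R^-1 *
  \sum_(s <- permutations (enum E))
    \sum_(r : seed A) seed_prob r * (run r s == w)%:R.

Definition approximates_walks (R : realType) (V : finType) (k S : nat)
    (eps : R) (A : stream_alg R V k S) (E : {set V * V}) : Prop :=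
  total_variation (output_prob A E) (@walk_prob R V k E) <= eps.

(* Main.v *)
Require Import Defs.
From mathcomp Require Import all_boot all_order all_algebra.
From mathcomp Require Import reals.
From mathcomp Require Import ring lra zify.

(** Every vertex has a single out-arc: sources point to a hub, the hub points
    to the vertex of an index [i], and the vertex of each index [j] points to
    one of two sinks, according to a bit [x j]. Almost all vertices are
    sources, so the third step of the walk must reveal [x i]. With probability
    1/2 the arc of the hub arrives after that of [i]; the memory then has to
    answer for all the indices seen so far, and a union bound over its 2 ^ S
    states, with an exponential moment of the number of right answers, shows
    that with o(n) bits it is right about half of the time on average. So the
    third step is right with probability at most 3/4 + o(1). *)

Set Implicit Arguments.
Unset Strict Implicit.
Unset Printing Implicit Defensive.

Import Order.TTheory GRing.Theory Num.Theory.

Local Open Scope ring_scope.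

(** * Bernoulli inequalities and the exponential moment *)

Lemma bernoulli_ge (R : realFieldType) (t : R) (n : nat) :
  -1 <= t -> 1 + n%:R * t <= (1 + t) ^+ n.
Proof.
move=> t_ge; elim: n => [|n IHn]; first by rewrite mul0r addr0 expr0.
rewrite exprS; apply: le_trans (ler_wpM2l _ IHn); last lra.
rewrite -natr1; have : 0 <= n%:R * t ^+ 2 :> R by rewrite mulr_ge0 ?sqr_ge0.
by nra.
Qed.

Lemma bernoulli_le (R : realFieldType) (t : R) (n : nat) :
  0 <= t -> (1 + t) ^+ n * (1 - n%:R * t) <= 1.
Proof.
move=> t_ge0; elim: n => [|n IHn]; first by rewrite mul0r subr0 expr0 mulr1.
apply: le_trans IHn; rewrite exprSr -mulrA ler_wpM2l ?exprn_ge0 ?addr_ge0 //.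
have : 0 <= n.+1%:R * t ^+ 2 :> R by rewrite mulr_ge0 ?sqr_ge0.
by rewrite -natr1; nra.
Qed.

(** The line through [(c, (1 + t) ^ c)] of slope [t * (1 + t) ^ c] stays below the exponential at
    the integers. It turns a bound on an exponential moment into one on the mean. *)
Lemma bernoulli_tangent (R : realFieldType) (t : R) (a c : nat) :
  0 <= t -> (1 + t * (a%:R - c%:R)) * (1 + t) ^+ c <= (1 + t) ^+ a.
Proof.
move=> t_ge0; case: (leqP c a) => [/subnKC <-|/ltnW/subnKC <-].
  rewrite natrD [c%:R + _]addrC addrK exprD [leRHS]mulrC.
  rewrite ler_wpM2r ?exprn_ge0 ?addr_ge0 //.
  by rewrite [t * _]mulrC bernoulli_ge //; lra.
set d := (c - a)%N; rewrite natrD opprD addNKr exprD mulrCA.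
rewrite -[leRHS]mulr1 ler_wpM2l ?exprn_ge0 ?addr_ge0 //.
by rewrite mulrC mulrN [t * _]mulrC bernoulli_le.
Qed.

(** The left side is the union bound: [2 ^ S] states times the mean of [(1 + u) ^ a], for [a] the
    number of heads among [p] fair coins. The right side allows an excess of [L] over [p / 2], which
    pays both for the number of states and for the variance of the coins. *)
Lemma moment_le (R : realFieldType) (q S L p : nat) (u := q%:R^-1 : R) :
  (0 < q)%N -> (2 * q * S <= L)%N -> (p <= q * L)%N ->
  2 ^+ S * (1 + u / 2) ^+ p <= (1 + u) ^+ (uphalf p + L).
Proof.
move=> q_gt0 leSL lepL.
have q0 : (0 : R) < q%:R by rewrite ltr0n.
have u_gt0 : 0 < u by rewrite invr_gt0.
have u_le1 : u <= 1 by rewrite invf_le1 // ler1n.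
have qu : q%:R * u = 1 by rewrite mulfV // gt_eqF.
have leS : 2 ^+ S <= (1 + u / 2) ^+ L.
  apply: (@le_trans _ _ ((1 + u / 2) ^+ (2 * q * S))).
    rewrite [X in _ <= X]exprM lerXn2r ?nnegrE ?exprn_ge0 //; try lra.
    apply: le_trans (@bernoulli_ge _ (u / 2) (2 * q) _); last lra.
    by rewrite natrM; nra.
  by rewrite ler_weXn2l //; lra.
have leh : (1 + u / 2) ^+ p <=
    (1 + u) ^+ (uphalf p) * (1 + u ^+ 2 / 4) ^+ (q * L).
  apply: (@le_trans _ _ ((1 + u / 2) ^+ (2 * uphalf p))).
    by rewrite ler_weXn2l //; [lra|lia].
  (* The square of [1 + u / 2] exceeds [1 + u] only by [u ^ 2 / 4]. *)
  rewrite exprM.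
  apply: (@le_trans _ _ (((1 + u) * (1 + u ^+ 2 / 4)) ^+ uphalf p)).
    rewrite lerXn2r ?nnegrE ?exprn_ge0 ?mulr_ge0 //; nra.
  rewrite exprMn ler_wpM2l ?exprn_ge0 //; first lra.
  by rewrite ler_weXn2l //; [nra|lia].
apply: (le_trans (ler_pM _ _ leS leh)); rewrite ?exprn_ge0 //; try lra.
rewrite mulrCA exprD ler_wpM2l ?exprn_ge0 //; first lra.
rewrite exprM -exprMn lerXn2r ?nnegrE ?mulr_ge0 ?exprn_ge0 //; try nra.
(* Per unit of [L], it remains that [(1 + u / 2) * (1 + u ^ 2 / 4) ^ q <= 1 + u]. *)
have := @bernoulli_le _ (u ^+ 2 / 4) q _.
have -> : q%:R * (u ^+ 2 / 4) = u / 4 by rewrite expr2 mulrA mulrA qu mul1r.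
move=> /(_ ltac:(nra)).
have : 0 <= (1 + u ^+ 2 / 4) ^+ q by rewrite exprn_ge0 //; nra.
move: (_ ^+ q) => Z Z0 Z1.
by nra.
Qed.

(** * Guesses against uniformly random bits *)

(** Once the bits outside [P] are fixed, so is [y], and the agreements on [P] are independent fair
    coins, each giving a factor [1 + z]. *)
Lemma sum_expr_agree (R : realFieldType) (m : nat) (P : {set 'I_m}) (z : R)
    (y : {ffun 'I_m -> bool} -> 'I_m -> bool) :
  (forall x x' : {ffun 'I_m -> bool}, {in ~: P, x =1 x'} -> y x =1 y x') ->
  \sum_(x : {ffun 'I_m -> bool}) z ^+ #|[set i in P | x i == y x i]| =
  2 ^+ (m - #|P|) * (1 + z) ^+ #|P|.
Proof.
move=> y_off.
(* [flip] turns the guesses of [y] into constant ones. *)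
pose flip (x : {ffun 'I_m -> bool}) : {ffun 'I_m -> bool} :=
  [ffun i => if i \in P then x i (+) y x i else x i].
have y_flip x : y (flip x) =1 y x.
  by apply: y_off => j; rewrite inE => /negPf nPj; rewrite ffunE nPj.
have flipK : involutive flip.
  move=> x; apply/ffunP=> i; rewrite !ffunE y_flip.
  by case: (i \in P) => //=; rewrite addbK.
rewrite (reindex_inj (inv_inj flipK)) /=.
(* After the flip, the guess at [i] in [P] is right exactly when the bit there is false. *)
pose F (i : 'I_m) (b : bool) : R := if (i \in P) && ~~ b then z else 1.
transitivity (\sum_(x : {ffun 'I_m -> bool}) \prod_i F i (x i)).
  apply: eq_bigr => x _; rewrite -prodr_const big_mkcond /=.
  apply: eq_bigr => i _; rewrite inE y_flip ffunE /F.
  by case: (i \in P) => //=; case: (x i); case: (y x i).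
rewrite -bigA_distr_bigA (bigID (mem P)) /= mulrC.
congr (_ * _).
  rewrite (eq_bigr (fun=> 2)) => [|i /negPf nPi]; last first.
    by rewrite big_bool /F nPi.
  rewrite (eq_bigl (mem (~: P))) => [|i]; last by rewrite !inE.
  by rewrite prodr_const cardsCs setCK card_ord.
rewrite (eq_bigr (fun=> 1 + z)) => [|i Pi]; last by rewrite big_bool /F Pi.
by rewrite prodr_const.
Qed.

(* Only the memory state may depend on the coordinates in [P], so for each of
   the few states the guess is independent of the bits that it has to match. *)
Lemma sum_agree_le (m q S L : nat) (P : {set 'I_m}) (T : finType)
    (st : {ffun 'I_m -> bool} -> T)
    (y : T -> {ffun 'I_m -> bool} -> 'I_m -> bool) :
  (0 < q)%N -> (2 * q * S <= L)%N -> (#|P| <= q * L)%N -> (#|T| <= 2 ^ S)%N ->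
  (forall t (x x' : {ffun 'I_m -> bool}),
    {in ~: P, x =1 x'} -> y t x =1 y t x') ->
  (\sum_(x : {ffun 'I_m -> bool}) #|[set i in P | x i == y (st x) x i]|
   <= 2 ^ m * (uphalf #|P| + L))%N.
Proof.
move=> q_gt0 leSL lePL leTS y_off; set p := #|P|; set c := (_ + L)%N.
pose a (x : {ffun 'I_m -> bool}) := #|[set i in P | x i == y (st x) x i]|.
pose u : rat := q%:R^-1.
have u_gt0 : 0 < u by rewrite invr_gt0 ltr0n.
have lepm : (p <= m)%N by rewrite -[m in leqRHS]card_ord max_card.
have moment : \sum_x (1 + u) ^+ a x <= 2 ^+ m * (1 + u) ^+ c.
  (* Union bound: the term of the actual state [st x] is at most the sum over all states. *)
  apply: (@le_trans _ _ (\sum_(x : {ffun 'I_m -> bool}) \sum_(t : T)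
      (1 + u) ^+ #|[set i in P | x i == y t x i]|)).
    apply: ler_sum => x _; rewrite (bigD1 (st x)) //= lerDl.
    by apply: sumr_ge0 => t _; rewrite exprn_ge0 //; lra.
  rewrite exchange_big /=.
  rewrite (eq_bigr (fun=> 2 ^+ (m - p) * (1 + (1 + u)) ^+ p)) => [|t _];
    last first.
    by rewrite sum_expr_agree //; apply: y_off.
  rewrite sumr_const -[_ *+ #|_|]mulr_natl.
  apply: (@le_trans _ _ (2 ^+ S * (2 ^+ (m - p) * (1 + (1 + u)) ^+ p))).
    rewrite ler_wpM2r ?mulr_ge0 ?exprn_ge0 //; first lra.
    by rewrite -natrX ler_nat.
  have -> : 1 + (1 + u) = 2 * (1 + u / 2) by lra.
  rewrite exprMn [leLHS](_ : _ = 2 ^+ m * (2 ^+ S * (1 + u / 2) ^+ p)).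
    by rewrite ler_wpM2l ?exprn_ge0 // moment_le.
  by rewrite -[in RHS](subnK lepm) exprD; ring.
(* The tangent at [c] plays the role of Jensen's inequality: the mean of [a x] is at most [c]. *)
have tangent : \sum_x (1 + u * ((a x)%:R - c%:R)) <= 2 ^+ m.
  rewrite -(@ler_pM2r _ ((1 + u) ^+ c)); last by rewrite exprn_gt0 //; lra.
  apply: le_trans moment; rewrite mulr_suml; apply: ler_sum => x _.
  by apply: bernoulli_tangent; lra.
have card_cube : #|{ffun 'I_m -> bool}| = (2 ^ m)%N.
  by rewrite card_ffun card_bool card_ord.
rewrite big_split /= sumr_const card_cube natrX gerDl -mulr_sumr in tangent.
rewrite (pmulr_rle0 _ u_gt0) in tangent.
move: tangent; rewrite sumrB sumr_const card_cube subr_le0 -natr_sum -mulrnA.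
by rewrite ler_nat mulnC.
Qed.

(** * Total variation on events; walks and streams on graphs of functions *)

(** As the total masses agree, [p] exceeds [q] off [A] by as much as [q] exceeds [p] on [A]; the
    factor 1/2 accounts for counting both. *)
Lemma total_variation_ge (R : realType) (T : finType) (p q : T -> R)
    (A : pred T) :
  \sum_x p x = \sum_x q x ->
  \sum_(x | A x) q x - \sum_(x | A x) p x <= total_variation p q.
Proof.
rewrite /total_variation [\sum_x `|_|](bigID A) [\sum_x p x](bigID A)
  [\sum_x q x](bigID A) /=.
have : \sum_(x | A x) (q x - p x) <= \sum_(x | A x) `|p x - q x|.
  by apply: ler_sum => x _; rewrite distrC ler_norm.
have : \sum_(x | ~~ A x) (p x - q x) <= \sum_(x | ~~ A x) `|p x - q x|.
  by apply: ler_sum => x _; rewrite ler_norm.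
rewrite !sumrB; lra.
Qed.

(** With one out-arc per vertex, a walk is determined by its start. *)
Definition arcs (V : finType) (f : V -> V) : {set V * V} :=
  [set (v, f v) | v : V].

Definition path_tuple (V : finType) (f : V -> V) (k : nat) (v : V) :
    k.+1.-tuple V := [tuple iter i f v | i < k.+1].

Section FunctionalGraph.
Variables (R : realType) (V : finType) (f : V -> V).

Lemma mem_arcs u v : ((u, v) \in arcs f) = (v == f u).
Proof.
by apply/imsetP/eqP => [[w _ [-> ->]]|->] //; exists u.
Qed.

Lemma card_arcs : #|arcs f| = #|V|.
Proof. by rewrite card_imset // => u v []. Qed.

Lemma outdeg_arcs u : outdeg (arcs f) u = 1%N.
Proof.
rewrite /outdeg -[RHS](cards1 (f u)); congr #|pred_of_set _|.
by apply/setP=> v; rewrite !inE mem_arcs.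
Qed.

Lemma walk_prob_arcs k (w : k.+1.-tuple V) :
  walk_prob R (arcs f) w = #|V|%:R^-1 * \sum_v (w == path_tuple f k v)%:R.
Proof.
rewrite /walk_prob; congr (_ * _).
(* The only start that can contribute is the first vertex of [w]. *)
rewrite (bigD1 (thead w)) //= [X in _ + X]big1 ?addr0 => [|v]; last first.
  by case: (w =P path_tuple f k v) => // ->; rewrite /thead tnth_mktuple eqxx.
transitivity (\prod_(i < k) (tnth w (lift ord0 i) ==
    f (tnth w (widen_ord (leqnSn k) i)))%:R : R).
  by apply: eq_bigr => i _; rewrite /step_prob mem_arcs outdeg_arcs divr1.
case: eqP => [->|neq_w].
  by rewrite big1 // => i _; rewrite !tnth_mktuple /= /bump /= eqxx.
apply/eqP/prodf_eq0/exists_inP; apply: contra_notT neq_w.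
rewrite negb_exists_in => /forall_inP steps; apply: eq_from_tnth => -[j ltjk].
rewrite tnth_mktuple /=; elim: j ltjk => [|j IHj] ltjk.
  by congr tnth; apply: val_inj.
have := steps (Ordinal (ltjk : j < k)%N) isT.
rewrite pnatr_eq0 eqb0 negbK => /eqP.
rewrite (_ : lift _ _ = Ordinal ltjk); last exact: val_inj.
move=> ->; rewrite iterS -(IHj (ltnW ltjk)).
by congr (f (tnth _ _)); apply: val_inj.
Qed.

Lemma sum_walk_prob_arcs k (A : pred (k.+1.-tuple V)) :
  \sum_(w | A w) walk_prob R (arcs f) w =
  #|V|%:R^-1 * #|[set v | A (path_tuple f k v)]|%:R.
Proof.
under eq_bigr do rewrite walk_prob_arcs.
rewrite -mulr_sumr exchange_big /=; congr (_ * _).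
rewrite -sum1_card natr_sum [RHS]big_mkcond; apply: eq_bigr => v _; rewrite inE.
case: ifP => Av.
  rewrite (bigD1 (path_tuple f k v)) //= eqxx big1 ?addr0 //.
  by move=> w /andP[_ /negPf->].
by apply: big1 => w Aw; case: eqP => // eqw; rewrite -eqw Aw in Av.
Qed.

Definition stream (s : seq V) : seq (V * V) := [seq (v, f v) | v <- s].

(** An arc is determined by its tail, so a random order of the arcs is a random order of the
    vertices. The orders thus become common to all the graphs of the family, and can be fixed before
    averaging over the graphs. *)
Lemma permutations_arcs :
  perm_eq (permutations (enum (arcs f))) (map stream (permutations (enum V))).
Proof.
have stream_inj : injective stream.
  by apply: inj_map => u v [].
have enumE : perm_eq (enum (arcs f)) (stream (enum V)).
  apply: uniq_perm; first exact: enum_uniq.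
    by rewrite map_inj_uniq ?enum_uniq // => u v [].
  move=> [u v]; rewrite mem_enum mem_arcs.
  apply/eqP/mapP => [->|[w _ [-> ->]]] //.
  by exists u; rewrite ?mem_enum.
apply: uniq_perm; rewrite ?map_inj_uniq ?permutations_uniq // => s.
rewrite mem_permutations (permPr enumE).
apply/idP/mapP => [s_perm|[t t_perm ->]].
  have sE : s = stream (map fst s).
    rewrite /stream -map_comp map_id_in // => -[u v].
    by rewrite (perm_mem s_perm) => /mapP[w _ [-> ->]].
  exists (map fst s) => //; rewrite mem_permutations.
  have := perm_map fst s_perm.
  by rewrite /stream -map_comp (eq_map (g := id)) // map_id.
by rewrite perm_map // -mem_permutations.
Qed.

Lemma sum_output_prob_arcs k S (A : stream_alg R V k S)
    (B : pred (k.+1.-tuple V)) :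
  \sum_(w | B w) output_prob A (arcs f) w =
  (#|V|`!)%:R^-1 * \sum_(s <- permutations (enum V))
    \sum_(r : seed A) seed_prob r * (B (run r (stream s)))%:R.
Proof.
rewrite /output_prob card_arcs -mulr_sumr; congr (_ * _).
rewrite exchange_big /= (perm_big _ permutations_arcs) big_map /=.
apply: eq_bigr => s _; rewrite exchange_big; apply: eq_bigr => r _ /=.
rewrite -mulr_sumr; congr (_ * _).
case BE: (B _).
  rewrite (bigD1 (run r (stream s))) //= eqxx big1 ?addr0 // => w /andP[_].
  by rewrite eq_sym => /negPf->.
by apply: big1 => w Bw; case: eqP => // eqw; rewrite eqw Bw in BE.
Qed.

Lemma sum_perm_const (c : R) :
  (#|V|`!)%:R^-1 * \sum_(s <- permutations (enum V)) c = c.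
Proof.
rewrite big_const_seq count_predT iter_addr_0 size_permutations ?enum_uniq //.
by rewrite -cardE -[c *+ _]mulr_natl mulKf // pnatr_eq0 -lt0n fact_gt0.
Qed.

Lemma approximates_event k S (eps : R) (A : stream_alg R V k S)
    (B : pred (k.+1.-tuple V)) :
  (0 < #|V|)%N -> approximates_walks eps A (arcs f) ->
  #|V|%:R^-1 * #|[set v | B (path_tuple f k v)]|%:R - eps <=
  (#|V|`!)%:R^-1 * \sum_(s <- permutations (enum V))
    \sum_(r : seed A) seed_prob r * (B (run r (stream s)))%:R.
Proof.
move=> V_gt0 approx; rewrite -sum_walk_prob_arcs -sum_output_prob_arcs.
rewrite lerBlDr -lerBlDl; apply: le_trans approx; apply: total_variation_ge.
(* Both distributions have total mass 1. *)
rewrite (sum_output_prob_arcs A predT) (sum_walk_prob_arcs predT).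
under eq_bigr do under eq_bigr do rewrite mulr1.
rewrite seed_prob_sum1 sum_perm_const -(_ : [set: V] = [set v | true]).
  by rewrite cardsT mulVf // pnatr_eq0 -lt0n.
by apply/setP => v; rewrite !inE.
Qed.

End FunctionalGraph.

(** * The hard family of graphs *)

(** The summand ['I_M] holds the sources, which make almost every start lead to the hub. *)
Definition vertex (M m : nat) : finType := ('I_M + option 'I_m + bool)%type.
Definition hub {M m : nat} : vertex M m := inl (inr None).
Definition bitv {M m : nat} (j : 'I_m) : vertex M m := inl (inr (Some j)).
Definition sink {M m : nat} (b : bool) : vertex M m := inr b.

(* The walk goes from a source to the hub, then to the vertex [h] of the
   queried index, and from there to the sink that encodes its bit. *)
Definition next (M m : nat) (x : {ffun 'I_m -> bool}) (h v : vertex M m) :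
    vertex M m :=
  match v with
  | inl (inl _) => hub
  | inl (inr None) => h
  | inl (inr (Some j)) => sink (x j)
  | inr b => sink (~~ b)
  end.

(** Arcs lead to a vertex of another kind, except that the two sinks point to each other. *)
Lemma next_neq (M m : nat) (x : {ffun 'I_m -> bool})
    (i : 'I_m) (v : vertex M m) :
  next x (bitv i) v != v.
Proof. by case: v => [[a|[j|]]|[]]. Qed.

Lemma card_vertex (M m : nat) : #|vertex M m| = (M + m + 3)%N.
Proof. by rewrite !card_sum card_option !card_ord card_bool; lia. Qed.

(** * Right guesses for a fixed order of the stream *)

(** Before the hub, the stream does not depend on the queried index [i]; after it, no bit of an
    index in [P] is read again. So for indices in [P] the guess knows these bits only through the
    memory state at the hub. *)
Lemma sum_guess_le (M m q S L : nat) (s1 s2 : seq (vertex M m))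
    (upd : S.-tuple bool -> vertex M m * vertex M m -> S.-tuple bool)
    (st0 : S.-tuple bool) (guess : S.-tuple bool -> bool)
    (P := [set j | bitv j \in s1]) :
  uniq (s1 ++ hub :: s2) ->
  (0 < q)%N -> (2 * q * S <= L)%N -> (m <= q * L)%N ->
  (\sum_(x : {ffun 'I_m -> bool}) \sum_(i < m)
     (guess (foldl upd st0 (stream (next x (bitv i)) (s1 ++ hub :: s2))) == x i)
   <= 2 ^ m * (m - #|P| + uphalf #|P| + L))%N.
Proof.
move=> uniq_s q_gt0 leSL lemL.
(* The target of the hub is a dummy here, as the arc of the hub is not in [s1]. *)
pose st x := foldl upd st0 (stream (next x hub) s1).
pose y t x i := guess (foldl upd t (stream (next x (bitv i)) (hub :: s2))).
move: uniq_s; rewrite cat_uniq => /and3P[_ disj _].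
have st_hub x i : foldl upd st0 (stream (next x (bitv i)) s1) = st x.
  congr foldl; apply/eq_in_map => -[[a|[j|]]|b] //= in_s1.
  by case/hasP: disj; exists hub; rewrite ?mem_head.
have y_off t (x x' : {ffun 'I_m -> bool}) :
    {in ~: P, x =1 x'} -> y t x =1 y t x'.
  move=> eq_x i; congr (guess (foldl _ _ _)).
  apply/eq_in_map => -[[a|[j|]]|b] //= in_s2; rewrite eq_x // !inE.
  by apply: contra disj => in_s1; apply/hasP; exists (bitv j).
have lePL : (#|P| <= q * L)%N.
  by apply: leq_trans lemL; rewrite -[m in leqRHS]card_ord max_card.
have leTS : (#|{: S.-tuple bool}| <= 2 ^ S)%N by rewrite card_tuple card_bool.
have := sum_agree_le st q_gt0 leSL lePL leTS y_off.
set sum_agree := (X in (X <= _)%N) => agree.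
rewrite -addnA mulnDr.
(* All the indices outside [P] are conceded as right guesses. *)
apply: (@leq_trans (2 ^ m * (m - #|P|) + sum_agree)); last first.
  by rewrite leq_add2l.
have -> : (2 ^ m * (m - #|P|) = \sum_(x : {ffun 'I_m -> bool}) #|~: P|)%N.
  rewrite sum_nat_const card_ffun card_bool card_ord.
  by rewrite [#|~: P|]cardsCs setCK card_ord.
rewrite -big_split /=; apply: leq_sum => x _.
rewrite -!sum1_card [X in (_ <= X + _)%N]big_mkcond.
rewrite [X in (_ <= _ + X)%N]big_mkcond -big_split /=; apply: leq_sum => i _.
rewrite /stream map_cat foldl_cat -/(stream _ _) st_hub.
rewrite -/(stream _ _) -/(y _ x i).
by rewrite !inE [x i == _]eq_sym; case: (bitv i \in s1) => //=; case: eqP.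
Qed.

(** * Averaging over the orders *)

Definition before (M m : nat) (s : seq (vertex M m)) : {set 'I_m} :=
  [set j | bitv j \in take (index hub s) s].

Lemma before_cat (M m : nat) (s1 s2 : seq (vertex M m)) :
  hub \notin s1 -> before (s1 ++ hub :: s2) = [set j | bitv j \in s1].
Proof.
move=> nin; apply/setP => j; rewrite !inE index_cat (negPf nin) /= addn0.
by rewrite take_size_cat.
Qed.

(** In an order of all the vertices, each index lies on exactly one side of the hub, and reversal
    swaps the sides. *)
Lemma before_rev (M m : nat) (s : seq (vertex M m)) :
  uniq s -> (forall v, v \in s) -> before (rev s) = ~: before s.
Proof.
move=> uniq_s full; have hub_s := full hub; move: uniq_s full.
case/splitPr: hub_s => s1 s2; rewrite cat_uniq => /and3P[_ /=].
rewrite negb_or => /andP[nin1 disj] /andP[nin2 _] full.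
rewrite rev_cat rev_cons cat_rcons !before_cat ?mem_rev //.
apply/setP => j; rewrite !inE mem_rev; have := full (bitv j).
rewrite mem_cat in_cons /=; case: (boolP (bitv j \in s1)) => //= in1 _.
by apply: contraNF disj => in2; apply/hasP; exists (bitv j).
Qed.

(* Reversing the order of the arcs exchanges [before s] and its complement, so
   [before s] has m / 2 elements on average. *)
Lemma sum_before_le (M m L : nat) :
  (4 * \sum_(s <- permutations (enum (vertex M m)))
     (m - #|before s| + uphalf #|before s| + L) <=
   (3 * m + 2 + 4 * L) * #|vertex M m|`!)%N.
Proof.
set V := vertex M m.
pose D (s : seq V) := (m - #|before s| + uphalf #|before s| + L)%N.
have D_rev : (\sum_(s <- permutations (enum V)) D s =
    \sum_(s <- permutations (enum V)) D (rev s))%N.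
  rewrite -(big_map rev xpredT D); apply: perm_big; apply: uniq_perm.
  - exact: permutations_uniq.
  - by rewrite map_inj_uniq ?permutations_uniq //; apply: inv_inj revK.
  move=> s; apply/idP/mapP => [s_perm|[t]].
    exists (rev s); rewrite ?revK // mem_permutations perm_rev.
    by rewrite -mem_permutations.
  by rewrite !mem_permutations => t_perm ->; rewrite perm_rev.
(* One factor 2 pairs [s] with [rev s], the other clears the halves; the two roundings up in
   [uphalf] give the summand 2. *)
rewrite -/(\sum_(s <- _) D s)%N (_ : 4 = 2 * 2)%N // -mulnA.
rewrite [(2 * \sum_(s <- _) _)%N]mul2n -addnn.
rewrite [X in (_ + X)%N]D_rev -big_split /=.
rewrite [(#|_|`!)%N](_ : _ = \sum_(s <- permutations (enum V)) 1)%N; last first.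
  by rewrite sum1_size size_permutations ?enum_uniq // cardE.
rewrite !big_distrr /= big_seq [leqRHS]big_seq; apply: leq_sum => s.
rewrite mem_permutations => s_perm.
rewrite /D before_rev; last 2 first.
- by rewrite (perm_uniq s_perm) enum_uniq.
- by move=> v; rewrite (perm_mem s_perm) mem_enum.
rewrite [#|~: _|]cardsCs setCK card_ord.
have := max_card (before s); rewrite card_ord.
by move: #|_| => p; lia.
Qed.

(** * Success probability of an approximating algorithm *)

(** The probability that the third step of the output reveals [x i] is averaged over [x] and [i].
    Closeness to the walk, which is right from each of the [M] sources, bounds it below; counting
    right guesses for each order and seed bounds it above. *)
Lemma approximation_gap (R : realType) (eps : R) (k S M q L : nat)
    (m := (q * L)%N) (A : stream_alg R (vertex M m) k S) :
  (3 <= k)%N -> (0 < q)%N -> (2 * q * S <= L)%N ->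
  (forall x i, approximates_walks eps A (arcs (next x (bitv i)))) ->
  4 * m%:R * (M%:R / (M + m + 3)%:R - eps) <= (3 * m + 2 + 4 * L)%:R.
Proof.
move=> le3k q_gt0 leSL approx.
pose V := vertex M m.
pose B b : pred (k.+1.-tuple V) := fun w => tnth w (inord 3) == sink b.
have good (x : {ffun 'I_m -> bool}) (i : 'I_m) :
    (M <= #|[set v | B (x i) (path_tuple (next x (bitv i)) k v)]|)%N.
  rewrite -[M in leqLHS]card_ord -(@card_imset _ _ (fun a => inl (inl a) : V)).
    apply/subset_leq_card/subsetP => _ /imsetP[a _ ->].
    by rewrite inE /B tnth_mktuple inordK //= ltnS.
  by move=> a b [].
have V_gt0 : (0 < #|V|)%N by rewrite card_vertex addnS.
pose hit (x : {ffun 'I_m -> bool}) (i : 'I_m) (s : seq V) (r : seed A) :=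
  B (x i) (run r (stream (next x (bitv i)) s)).
pose pr (x : {ffun 'I_m -> bool}) (i : 'I_m) : R :=
  (#|V|`!)%:R^-1 * \sum_(s <- permutations (enum V))
    \sum_(r : seed A) seed_prob r * (hit x i s r)%:R.
have pr_ge x i : M%:R / (M + m + 3)%:R - eps <= pr x i.
  apply: le_trans (approximates_event (B (x i)) V_gt0 (approx x i)).
  rewrite lerB // -card_vertex mulrC ler_wpM2l ?invr_ge0 ?ler0n // ler_nat.
  exact: good.
have sum_ge : 2 ^+ m * m%:R * (M%:R / (M + m + 3)%:R - eps) <=
    \sum_(x : {ffun 'I_m -> bool}) \sum_(i < m) pr x i.
  apply: (@le_trans _ _ (\sum_(x : {ffun 'I_m -> bool}) \sum_(i < m)
    (M%:R / (M + m + 3)%:R - eps))); last first.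
    by apply: ler_sum => x _; apply: ler_sum.
  rewrite !sumr_const card_ffun card_bool !card_ord -mulrnA -[leRHS]mulr_natl.
  by rewrite -natrX -natrM mulnC.
have hit_le s r : s \in permutations (enum V) ->
    \sum_(x : {ffun 'I_m -> bool}) \sum_(i < m) (hit x i s r)%:R <=
    (2 ^ m * (m - #|before s| + uphalf #|before s| + L))%:R :> R.
  rewrite mem_permutations => s_perm.
  have uniq_s : uniq s by rewrite (perm_uniq s_perm) enum_uniq.
  have hub_s : hub \in s by rewrite (perm_mem s_perm) mem_enum.
  case/splitPr: hub_s uniq_s {s_perm} => s1 s2 uniq_s.
  rewrite before_cat; last first.
    by move: uniq_s; rewrite cat_uniq /= negb_or => /and3P[_ /andP[]].
  (* Any output other than [sink true] is read as the bit false, so every hit is a right guess. *)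
  pose guess t := tnth (output r t) (inord 3) == sink true.
  have := sum_guess_le (update r) (init r) guess uniq_s q_gt0 leSL (leqnn m).
  rewrite -(ler_nat R); apply: le_trans.
  rewrite natr_sum; apply: ler_sum => x _.
  rewrite natr_sum; apply: ler_sum => i _.
  rewrite ler_nat /hit /B /run /guess.
  by case: eqP => // ->; case: (x i).
have sum_le : \sum_(x : {ffun 'I_m -> bool}) \sum_(i < m) pr x i <=
    (#|V|`!)%:R^-1 * \sum_(s <- permutations (enum V))
      (2 ^ m * (m - #|before s| + uphalf #|before s| + L))%:R.
  under eq_bigr do rewrite -mulr_sumr exchange_big /=.
  rewrite -mulr_sumr ler_wpM2l ?invr_ge0 ?ler0n // exchange_big /=.
  rewrite big_seq [leRHS]big_seq; apply: ler_sum => s s_perm.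
  under eq_bigr do rewrite exchange_big /=.
  rewrite exchange_big /= -[leRHS]mul1r.
  rewrite -[X in _ <= X * _](seed_prob_sum1 A) mulr_suml.
  apply: ler_sum => r _.
  under eq_bigr do rewrite -mulr_sumr.
  by rewrite -mulr_sumr ler_wpM2l ?seed_prob_ge0 // hit_le.
move: (le_trans sum_ge sum_le); rewrite -natr_sum -big_distrr /= natrM natrX.
rewrite mulrCA -mulrA ler_pM2l ?exprn_gt0 //.
have := sum_before_le M m L.
rewrite -(ler_nat R) natrM [in X in _ <= X -> _]natrM.
have fact_V : 0 < (#|V|`!)%:R :> R by rewrite ltr0n fact_gt0.
rewrite -ler_pdivrMr // => sum4 gap; apply: le_trans sum4.
by rewrite -[leLHS]mulrA -[leRHS]mulrA ler_wpM2l // [leRHS]mulrC.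
Qed.

(** * Choice of the parameters *)

Theorem theorem1p7 (R : realType) (eps : R) (heps : eps < 1 / 4) :
  exists (c : R) (n0 : nat), 0 < c /\
    forall k n : nat, (3 <= k)%N -> (n0 <= n)%N ->
      exists (V : finType) (F : {set {set V * V}}),
        [/\ (0 < #|V| <= n)%N,
            forall E : {set V * V}, E \in F ->
              [/\ loopless E, sinkless E & (#|E| <= n)%N]
          & forall (S : nat) (A : stream_alg R V k S),
              (forall E : {set V * V}, E \in F -> approximates_walks eps A E) ->
              c * n%:R <= S%:R].
Proof.
(* The bound makes [4 / q] smaller than the gap [1 / 4 - eps]; the shift ensures [2 <= q]. *)
set q := (Num.Def.archi_bound (4 / (1 / 4 - eps))).+2.
have gap_gt0 : 0 < 1 / 4 - eps by lra.
have q_big : 4 < (1 / 4 - eps) * q%:R.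
  rewrite mulrC -ltr_pdivrMr //.
  apply: (lt_trans (archi_boundP _)); first by rewrite divr_ge0 // ltW.
  by rewrite ltr_nat ltnS leqnSn.
have q_ge2 : (2 <= q)%N by [].
move: q q_big q_ge2 => q q_big q_ge2.
have q_gt0 : (0 : R) < q%:R by rewrite ltr0n; lia.
(* With [L] about [n / q ^ 3], a space below [c * n] forces [2 * q * S <= L], and [n0] forces
   [3 <= L]. *)
exists (4 * q%:R ^+ 4)^-1, (3 * q ^ 3)%N.
split; first by rewrite invr_gt0 mulr_gt0 // exprn_gt0.
move=> k n le3k le_n0n.
(* The indices take at most [n / q ^ 2] vertices; sources fill up to exactly [n] vertices, hence [n]
   arcs. *)
pose L := (n %/ q ^ 3)%N; pose m := (q * L)%N; pose M := (n - (m + 3))%N.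
have q3_gt0 : (0 < q ^ 3)%N by rewrite expn_gt0; lia.
have L_le : (L * q ^ 3 <= n)%N by apply: leq_trunc_div.
have L_gt : (n < L.+1 * q ^ 3)%N by rewrite ltn_ceil.
have L_ge3 : (3 <= L)%N by rewrite leq_divRL.
have qm_le : (q ^ 2 * m <= n)%N.
  by apply: leq_trans L_le; rewrite /m mulnA -expnSr mulnC.
have q2_ge4 : (2 ^ 2 <= q ^ 2)%N by rewrite leq_exp2r.
have lemn : (m + 3 <= n)%N by nia.
have MnE : (M + m + 3 = n)%N by rewrite -addnA subnK.
exists (vertex M m),
  [set arcs (next x (bitv i)) | x : {ffun 'I_m -> bool}, i : 'I_m].
split.
- by rewrite card_vertex MnE leqnn andbT; lia.
- move=> _ /imset2P[x i _ _ ->]; split.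
  + by move=> u; rewrite mem_arcs eq_sym next_neq.
  + by move=> u; rewrite outdeg_arcs.
  + by rewrite card_arcs card_vertex MnE.
move=> S A approx; rewrite leNgt; apply/negP => S_lt.
have n_gt0 : (0 : R) < n%:R by rewrite ltr0n; lia.
have leSL : (2 * q * S <= L)%N.
  move: S_lt; rewrite mulrC ltr_pdivlMr ?mulr_gt0 ?exprn_gt0 //.
  rewrite -natrX -!natrM ltr_nat expnS => S_lt.
  rewrite leqNgt; apply/negP => L_lt.
  have := leq_mul L_lt (leqnn (q ^ 3)); move: S_lt L_gt; clear.
  by move: (q ^ 3)%N => c; lia.
have : 4 * m%:R * (M%:R / (M + m + 3)%:R - eps) <= (3 * m + 2 + 4 * L)%:R.
  apply: (@approximation_gap R eps k S M q L A) => //; first lia.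
  by move=> x i; apply: approx; apply/imset2P; exists x i.
rewrite MnE; apply/negP; rewrite -ltNge.
have ->: M%:R / n%:R = 1 - (m + 3)%:R / n%:R :> R.
  by rewrite natrB // mulrBl mulfV // gt_eqF.
(* The fraction of starts that are not sources. *)
have lost : (m + 3)%:R / n%:R <= q%:R^-1 :> R.
  by rewrite ler_pdivrMr // ler_pdivlMl // -natrM ler_nat; nia.
have lostm : m%:R * ((m + 3)%:R / n%:R) <= L%:R :> R.
  apply: le_trans (ler_wpM2l (ler0n _ _) lost) _.
  by rewrite natrM mulrAC mulfV ?mul1r // gt_eqF.
have L_gt0 : (3 : R) <= L%:R by rewrite ler_nat.
(* Multiplied by 4, the gap yields at least [16 * L], against [4 * L] for the lost starts, [4 * L]
   for the memory and 2 for rounding. *)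
have big : 4 * L%:R <= m%:R * (1 / 4 - eps).
  by rewrite natrM -mulrA mulrCA [4 * _]mulrC ler_wpM2l // [leRHS]mulrC ltW.
move: lostm big; move: ((m + 3)%:R / n%:R) => e.
by rewrite !natrD !natrM; move: (q%:R * L%:R) => mr; lra.
Qed.
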